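(* Let $G$ be a finite group and let $A$ be a maximal abelian subgroup of $G$. Suppose that there exist proper subgroups $A_1,\ldots,A_n$ of $A$ such that every element in $$A^\circ := A\setminus (A_1\cup A_2\cup\cdots\cup A_n)$$ is abstractly regular. Let $N=N(A)$ denote the normalizer of $A$ in $G$. If $\chi$ is any irreducible (complex) character of $G$, then $$|\chi(a)|\le (4/\sqrt{3})^n\,[N:A]$$ for all $a\in A^\circ$.
   Context: An element $a$ of a finite group $G$ is called abstractly regular if its centralizer $Z(a)$ in $G$ is abelian. A maximal abelian subgroup is a subgroup that is maximal under inclusion among the abelian subgroups of $G$. *)

(* Defs.v *)
From mathcomp Require Import all_boot all_order all_algebra all_fingroup all_field all_character.
Set Implicit Arguments.
Unset Strict Implicit.
Unset Printing Implicit Defensive.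

Import GroupScope.

Definition abstractly_regular (gT : finGroupType) (G : {group gT}) (a : gT) : bool :=
  (a \in G) && abelian 'C_G[a].

Definition maximal_abelian (gT : finGroupType) (G A : {group gT}) : bool :=
  [max A | (A \subset G) && abelian A].

(* Main.v *)
Require Import Defs.
From mathcomp Require Import all_boot all_order all_algebra all_fingroup all_field all_character.
From mathcomp Require Import ring.

(* For each i pick a linear character lambda_i of A, trivial on A_i, with
   |1 - lambda_i(a)| >= sqrt 3, and put f = prod_i (1 - lambda_i).  Then f chi_A
   is a virtual character of A supported on A°, so its value at a is at most the
   sum of the absolute values of its integer coordinates, hence at most
   '[f chi_A].  Since |f| <= 2^n and two elements of A° are G-conjugate only
   under N(A), comparing with '[chi] = 1 bounds this norm by 4^n [N(A) : A];
   dividing by |f(a)| >= (sqrt 3)^n gives the claim. *)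

Set Implicit Arguments.
Unset Strict Implicit.
Unset Printing Implicit Defensive.

Import Order.TTheory GRing.Theory Num.Theory GroupScope.
Local Open Scope ring_scope.

(** Parallelogram law for [1] and [w]; it converts [|1 - w|^2 < 3] into [|1 + w| > 1]. *)
Lemma sqr_norm_1B_1D (w : algC) :
  `|w| = 1 -> `|1 - w| ^+ 2 + `|1 + w| ^+ 2 = 4%:R.
Proof.
move=> w1; have ww : w * w^* = 1 by rewrite -normCK w1 expr1n.
by rewrite !normCK rmorphB rmorphD rmorph1 /=; ring: ww.
Qed.

(* If w maximizes |1 - w| and |1 - w|^2 < 3, then |1 + w| > 1, so that w^2 is
   strictly farther from 1 than w. *)
Lemma exists_lin_char_far (gT : finGroupType) (A B : {group gT}) (a : gT) :
    abelian A -> B \subset A -> a \in A :\: B ->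
  exists2 i : Iirr A, B \subset cfker 'chi_i & 3%:R <= `|1 - 'chi_i a| ^+ 2.
Proof.
move=> abA sBA /setDP[Aa B'a].
have linA i : 'chi[A]_i \is a linear_char by apply/char_abelianP.
have nBA : B <| A by rewrite -sub_abelian_normal.
pose P := [pred i : Iirr A | B \subset cfker 'chi_i].
(* The characters trivial on [B] have kernels meeting exactly in [B], so one of them separates [a]
   from [1]; this makes the maximum of [F] positive. *)
have [i0 Pi0 Fi0] : exists2 i0, P i0 & 'chi_i0 a != 1.
  apply/exists_inP; apply: contraR B'a => /exists_inPn all1.
  rewrite -(cap_cfker_normal nBA); apply/bigcapP => i Pi.
  by rewrite cfkerEirr inE lin_char1 //; apply/negPn/all1.
pose F i := `|1 - 'chi[A]_i a|.
(* The order on [algC] is only partial, but the values of [F] are real, hence comparable, so a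
   maximum exists. *)
have [|||//|i Pi maxF] := @extremum_inP _ _ (fun x y : algC => y <= x) i0 P F.
- by move=> i _ /=.
- by move=> j i k _ _ _ /= le1 le2; apply: le_trans le2 le1.
- by move=> i j _ _ /=; apply: real_leVge; apply: normr_real.
exists i => //; rewrite real_leNgt ?rpredX ?normr_real //.
apply/negP => lt3.
have lin2 : 'chi_i * 'chi_i \is a linear_char by rewrite rpredM.
have /irrP[j Dj] : 'chi_i * 'chi_i \in irr A by apply: lin_char_irr.
have Pj : P j.
  apply/subsetP => b Bb; have /(subsetP Pi) := Bb.
  rewrite -Dj !cfkerEchar ?irr_char ?lin_charW // !inE => /andP[-> /eqP Eb].
  by rewrite !cfunE Eb eqxx.
have Fj : F j = F i * `|1 + 'chi_i a|.
  by rewrite /F -Dj !cfunE -normrM; congr `|_|; ring.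
have gt1 : 1 < `|1 + 'chi_i a|.
  rewrite -(@ltr_pXn2r _ 2) ?nnegrE ?normr_ge0 // expr1n.
  rewrite -(ltrD2l (`|1 - 'chi_i a| ^+ 2)) sqr_norm_1B_1D ?normC_lin_char //.
  by rewrite (_ : 4%:R = 3%:R + 1) ?ltrD2r ?natr1.
have Fgt0 : 0 < F i.
  by apply: lt_le_trans (maxF _ Pi0); rewrite normr_gt0 subr_eq0 eq_sym.
by have := maxF _ Pj; rewrite Fj ger_pMr // => /(lt_le_trans gt1); rewrite ltxx.
Qed.

(** Linear characters have modulus 1 at [a], and the integer coordinates [m] of [phi] satisfy
    [|m| <= m^2]. *)
Lemma norm_vchar_abelian_le (gT : finGroupType) (A : {group gT})
    (phi : 'CF(A)) (a : gT) :
  abelian A -> a \in A -> phi \in 'Z[irr A] -> `|phi a| <= '[phi].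
Proof.
move=> abA Aa Zphi; rewrite {1}[phi]cfun_sum_cfdot sum_cfunE cfdot_sum_irr.
apply: le_trans (ler_norm_sum _ _ _) _; apply: ler_sum => i _.
rewrite cfunE normrM normC_lin_char ?mulr1; [|exact/char_abelianP|by []].
have Zi := Cint_cfdot_vchar_irr i Zphi.
by rewrite -normCK intr_ler_sqr // intrE natr_norm_int //.
Qed.

(** Double counting of the pairs [(x, g)] with [g ^ x] in [S]: each [g] occurs at most [#|N|]
    times. *)
Lemma sum_sqr_norm_cfun_le (gT : finGroupType) (G N : {group gT})
    (S : {set gT}) (chi : 'CF(G)) :
    {in S & G, forall s g, (s ^ g)%g \in S -> g \in N} ->
  \sum_(s in S) `|chi s| ^+ 2 <= #|N|%:R * '[chi].
Proof.
move=> SN; rewrite (cfnormE (cfun_onG chi)) mulrCA ler_pdivlMl ?gt0CG //.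
have -> : #|G|%:R * (\sum_(s in S) `|chi s| ^+ 2)
    = \sum_(x in G) \sum_(g | (g ^ x)%g \in S) `|chi g| ^+ 2.
  rewrite mulr_natl -sumr_const; apply: eq_bigr => x Gx.
  rewrite (reindex_inj (conjg_inj x)) /=.
  by apply: eq_bigr => g _; rewrite cfunJ.
rewrite (exchange_big_dep predT) //= mulr_sumr big_mkcond [leRHS]big_mkcond /=.
apply: ler_sum => g _; case: ifP => [Gg|G'g]; last first.
  by rewrite big1 // => x _; rewrite cfun0 ?G'g // normr0 expr0n.
rewrite sumr_const -[leLHS]mulr_natl ler_wpM2r ?exprn_ge0 // ler_nat.
(* If [x0] and [x] both send [g] into [S], then [x0^-1 * x] sends [g ^ x0] into [S], so all such [x]
   lie in the coset [x0 N]. *)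
have [x0 /andP[Gx0 Sx0]|no_x] := pickP [pred x in G | (g ^ x)%g \in S]; last first.
  by rewrite eq_card0.
rewrite -(card_lcoset N x0); apply/subset_leq_card/subsetP => x /andP[Gx Sx].
rewrite mem_lcoset (SN ((g ^ x0)%g)) ?groupM ?groupV //.
by rewrite -conjgM mulKVg.
Qed.

Lemma cent1_maximal_abelian (gT : finGroupType) (G A : {group gT}) (a : gT) :
  maximal_abelian G A -> a \in A -> abstractly_regular G a -> 'C_G[a] = A.
Proof.
move=> /maxgroupP[/andP[sAG abA] maxA] Aa /andP[_ abC].
apply: maxA; first by rewrite subsetIl.
by rewrite subsetI sAG sub_cent1 (subsetP abA).
Qed.

Theorem theorem3 (gT : finGroupType) (G A : {group gT}) (n : nat)
    (B : 'I_n -> {group gT}) :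
  maximal_abelian G A ->
  (forall i : 'I_n, B i \proper A) ->
  (forall a : gT, a \in A :\: \bigcup_(i < n) B i -> abstractly_regular G a) ->
  forall chi : 'CF(G), chi \in irr G ->
  forall a : gT, a \in A :\: \bigcup_(i < n) B i ->
  `|chi a| <= (4%:R / sqrtC 3%:R) ^+ n * #|'N_G(A) : A|%:R.
Proof.
move=> maxA ltBA regA chi /irrP[k ->] a Sa; set S := A :\: _ in Sa regA *.
have /maxgroupP[/andP[sAG abA] _] := maxA.
have [Aa B'a] := setDP Sa.
have linA i : 'chi[A]_i \is a linear_char by apply/char_abelianP.
(* Both [s] and [s ^ g] have centralizer [A] in [G], and conjugation by [g] carries the first
   centralizer to the second. *)
have SN : {in S & G, forall s g, (s ^ g)%g \in S -> g \in 'N_G(A)}.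
  move=> s g Ss Gg Ssg; rewrite inE Gg; apply/normP.
  have [[As _] [Asg _]] := (setDP Ss, setDP Ssg).
  rewrite -{1}(cent1_maximal_abelian maxA As (regA s Ss)) conjIg conjGid //.
  by rewrite -cent1J (cent1_maximal_abelian maxA Asg) ?regA.
have /fin_all_exists2[l lB la] i : exists2 j : Iirr A,
    B i \subset cfker 'chi_j & 3%:R <= `|1 - 'chi_j a| ^+ 2.
  apply: exists_lin_char_far => //; first exact: proper_sub.
  by rewrite inE Aa andbT; apply: contra B'a => Ba; apply/bigcupP; exists i.
pose f : 'CF(A) := \prod_i (1 - 'chi_(l i)).
have fE x : x \in A -> f x = \prod_i (1 - 'chi_(l i) x).
  by move=> Ax; rewrite prod_cfunE //; apply: eq_bigr => i _; rewrite !cfunE cfun1E Ax.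
pose phi := f * 'Res[A] 'chi_k.
have Zphi : phi \in 'Z[irr A].
  rewrite rpredM ?cfRes_vchar ?irr_vchar //.
  by apply: rpred_prod => i _; rewrite rpredB ?cfun1_vchar ?irr_vchar.
(* On [B i] the factor [1 - 'chi_(l i)] vanishes. *)
have phiS : phi \in 'CF(A, S).
  apply/cfun_onP => x S'x; have [Ax|A'x] := boolP (x \in A); last exact: cfun0.
  move: S'x; rewrite inE Ax andbT negbK => /bigcupP[i _ Bx].
  rewrite cfunE fE // (bigD1 i) //= (cfker1 (subsetP (lB i) _ Bx)).
  by rewrite lin_char1 // subrr !mul0r.
have f_le x : x \in A -> `|f x| <= 2%:R ^+ n.
  move=> Ax; rewrite fE // normr_prod -[n in _ ^+ n]card_ord -prodr_const.
  apply: ler_prod => i _; rewrite normr_ge0 /=.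
  by apply: le_trans (ler_normB _ _) _; rewrite normr1 normC_lin_char.
have f_ge : sqrtC 3%:R ^+ n <= `|f a|.
  rewrite fE // normr_prod -[n in _ ^+ n]card_ord -prodr_const.
  apply: ler_prod => i _; rewrite sqrtC_ge0 ler0n /=.
  by rewrite -(@ler_pXn2r _ 2) ?nnegrE ?sqrtC_ge0 ?ler0n // sqrtCK.
(* [#|A| * '[phi]] is a sum over [S] alone, where [|f|^2 <= 4^n]; the [|'chi_k|^2] there sum to at
   most [#|'N_G(A)|]. *)
have phi_le : '[phi] <= 4%:R ^+ n * #|'N_G(A) : A|%:R.
  have sAN : A \subset 'N_G(A) by rewrite subsetI sAG normG.
  rewrite (cfnormE phiS) ler_pdivrMl ?gt0CG // mulrCA -natrM Lagrange //.
  have := sum_sqr_norm_cfun_le 'chi_k SN.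
  rewrite cfnorm_irr mulr1 => /(ler_wpM2l (exprn_ge0 n (ler0n _ 4))).
  apply: le_trans; rewrite mulr_sumr; apply: ler_sum => x /setDP[Ax _].
  rewrite cfunE cfResE // normrM exprMn ler_wpM2r ?exprn_ge0 //.
  rewrite (_ : 4%:R = 2%:R ^+ 2 :> algC); last by rewrite -natrX.
  by rewrite exprAC lerXn2r ?nnegrE ?exprn_ge0 ?ler0n ?f_le.
have s3 : 0 < sqrtC 3%:R ^+ n :> algC by rewrite exprn_gt0 // sqrtC_gt0 ltr0n.
rewrite expr_div_n mulrAC ler_pdivlMr // mulrC.
apply: le_trans phi_le; apply: le_trans (norm_vchar_abelian_le abA Aa Zphi).
by rewrite cfunE cfResE // normrM ler_wpM2r.
Qed.
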